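(* Let $L_1,L_2\ge1$ and consider two groups of moduli $m_{i,k}=m^{(i)}\Gamma_{i,k}$ ($i=1,2$, $1\le k\le L_i$), where $m^{(i)}\ge1$ are integers and, for each $i$, the integers $\Gamma_{i,1},\dots,\Gamma_{i,L_i}\ge1$ are pairwise co-prime. Let $\eta_i=\mathrm{lcm}(m_{i,1},\dots,m_{i,L_i})$, assume $\eta_1<\eta_2$, let $m=\gcd(\eta_1,\eta_2)$, $\Gamma_i=\eta_i/m$, and assume $\Gamma_1>1$. Let $1\le j\le K+1$ (with $\sigma_j,K,\ddot n_{2,j},\ddot n_{1,j}$ computed from $\Gamma_1,\Gamma_2$ as in the context) and put $X=\min\big(\eta_2(1+\ddot n_{2,j}),\,\eta_1(1+\ddot n_{1,j})\big)$. Let $\tau_1,\tau_2\ge0$ be reals with $$\tau_1<\frac{m^{(1)}}{4},\qquad \tau_2<\frac{m^{(2)}}{4},\qquad \tau_1+\tau_2<\frac{m\sigma_j}{2}.$$ Then there exists a map $\Phi$ from tuples $(\tilde r_{i,k})_{i,k}$ of integers to tuples of integers such that for every integer $N$ with $0\le N<X$ and every tuple of integers $\tilde r_{i,k}$ with $0\le\tilde r_{i,k}<m_{i,k}$ and $|\tilde r_{i,k}-|N|_{m_{i,k}}|\le\tau_i$ for all $i,k$, one has $\Phi((\tilde r_{i,k})_{i,k})=(\lfloor N/m_{i,k}\rfloor)_{i,k}$; i.e., all folding integers of $N$ modulo the $m_{i,k}$ are accurately determined by the erroneous remainders.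
   Context: $|a|_b$ is the remainder of the integer $a$ modulo the positive integer $b$. Euclidean sequence for co-prime $1<\Gamma_1<\Gamma_2$: $\sigma_{-1}=\Gamma_2$, $\sigma_0=\Gamma_1$, $\sigma_i=|\sigma_{i-2}|_{\sigma_{i-1}}$ for $i\ge1$; $K\ge0$ is the index with $\sigma_K>1$, $\sigma_{K+1}=1$. For $1\le n<\Gamma_1$, $S_{2,n}=\{|t\Gamma_2|_{\Gamma_1}:0\le t\le n\}$ and $d_{2,n}$ is the minimum distance between distinct elements of $S_{2,n}$; for $1\le n<\Gamma_2$, $S_{1,n}=\{|t\Gamma_1|_{\Gamma_2}:0\le t\le n\}$ and $d_{1,n}$ likewise. $\ddot n_{2,j}=\max\{n:1\le n<\Gamma_1,\ d_{2,n}\ge\sigma_j\}$, $\ddot n_{1,j}=\max\{n:1\le n<\Gamma_2,\ d_{1,n}\ge\sigma_j\}$. The groups may overlap (a modulus may appear in both). *)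

(* Defs.v *)
From HB Require Import structures.
From mathcomp Require Import all_boot all_order all_algebra.
Set Implicit Arguments. Unset Strict Implicit. Unset Printing Implicit Defensive.

(* Euclidean sequence for (G1, G2): euclid_pair i = (sigma_{i-1}, sigma_i). *)
Fixpoint euclid_pair (G1 G2 : nat) (i : nat) : nat * nat :=
  match i with
  | 0 => (G2, G1)
  | i'.+1 => let p := euclid_pair G1 G2 i' in (p.2, p.1 %% p.2)
  end.

(* sigma G1 G2 i = sigma_i for i >= 0 (sigma_0 = G1, sigma_{-1} = G2). *)
Definition sigma (G1 G2 : nat) (i : nat) : nat := (euclid_pair G1 G2 i).2.

Definition ndist (x y : nat) : nat := maxn x y - minn x y.

(* d_n for S_n = { |t a|_b : 0 <= t <= n }: minimum distance between distinct
   elements.  All elements lie in [0, b), so b is a neutral upper bound. *)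
Definition mindist (a b n : nat) : nat :=
  \big[minn/b]_(t1 < n.+1)
    \big[minn/b]_(t2 < n.+1 | (t1 * a) %% b != (t2 * a) %% b)
      ndist ((t1 * a) %% b) ((t2 * a) %% b).

(* nddot a b s = max { n : 1 <= n < b, mindist a b n >= s }.
   n_ddot_{2,j} = nddot G2 G1 (sigma_j), n_ddot_{1,j} = nddot G1 G2 (sigma_j). *)
Definition nddot (a b s : nat) : nat :=
  \max_(1 <= n < b | s <= mindist a b n) n.

Definition lcm_moduli (L : nat) (mi : nat) (G : 'I_L -> nat) : nat :=
  \big[lcmn/1]_(k < L) (mi * G k).

(* Main.v *)
(* Two numbers N, N' compatible with the same erroneous remainders differ, in
   group i, by A_i * eta_i + e_i with |e_i| <= 2 tau_i: the differences of their
   remainders modulo the m_{i,k} all agree modulo m^(i) and are smaller than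
   m^(i) / 2, hence coincide.  Therefore |A_1 Gamma_1 - A_2 Gamma_2| < sigma_j,
   while the range of N forces |A_i| to be at most the corresponding n_ddot.
   If A_1 and A_2 were not both 0, this small difference would be the remainder
   of a multiple of one Gamma_i modulo the other, against the minimum distance
   bound.  So the folding integers are unique, and Phi is a search over the
   finitely many N. *)
Require Import Defs.
From HB Require Import structures.
From mathcomp Require Import all_boot all_order all_algebra.
From mathcomp Require Import zify lra.
Import Order.TTheory GRing.Theory Num.Theory.
Local Open Scope ring_scope.

Set Implicit Arguments.
Unset Strict Implicit.

Lemma mindist_leq_modulus (a b n : nat) : (mindist a b n <= b)%N.
Proof. by rewrite /mindist -minEnat -leEnat bigmin_le_id. Qed.

Lemma mindist_leq_mod (a b n t : nat) :
  (t <= n)%N -> ((t * a) %% b != 0)%N -> (mindist a b n <= (t * a) %% b)%N.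
Proof.
move=> le_tn ta_neq0; rewrite /mindist -minEnat -!leEnat.
have t_ord : (t < n.+1)%N by [].
apply: le_trans (bigmin_le _ ord0 _) _.
apply: le_trans (bigmin_le_cond _ (j := Ordinal t_ord) _ _) _.
  by rewrite /= mul0n mod0n eq_sym.
by rewrite /ndist /= mul0n mod0n max0n min0n subn0.
Qed.

Lemma mindist_le_diff (a b n t : nat) (u : int) :
  (t <= n)%N -> 0 < t%:Z * a%:Z - u * b%:Z ->
  (mindist a b n)%:Z <= t%:Z * a%:Z - u * b%:Z.
Proof.
move=> le_tn; set d := _ - _ => d_gt0.
have [le_bd | lt_db] := leP b%:Z d.
  by apply: le_trans le_bd; rewrite lez_nat mindist_leq_modulus.
have modE : ((t * a) %% b)%N%:Z = d.
  rewrite -modz_nat PoszM -(subrK (u * b%:Z) (_ * _)) -/d addrC modzMDl.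
  by rewrite modz_small // ltW.
by rewrite -modE lez_nat mindist_leq_mod // -eqz_nat modE gt_eqF.
Qed.

Lemma leq_mindist_nddot (a b s : nat) :
  (0 < nddot a b s)%N -> (s <= mindist a b (nddot a b s))%N.
Proof.
rewrite /nddot; elim/big_rec: _ => // n N le_s IH.
by case: (leqP n N) => // _; apply: IH.
Qed.

Lemma nddot_le_diff (a b s t : nat) (u : int) :
  (0 < t <= nddot a b s)%N -> 0 < t%:Z * a%:Z - u * b%:Z ->
  s%:Z <= t%:Z * a%:Z - u * b%:Z.
Proof.
move=> /andP[t_gt0 le_t] d_gt0; apply: le_trans (mindist_le_diff le_t d_gt0).
by rewrite lez_nat leq_mindist_nddot // (leq_trans t_gt0).
Qed.

Lemma nddot_le_combination (a b s : nat) (x y : int) :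
  (`|x| <= nddot a b s)%N -> (`|y| <= nddot b a s)%N ->
  x * a%:Z != y * b%:Z -> s%:Z <= `|x * a%:Z - y * b%:Z|.
Proof.
wlog lt_yx : x y / y * b%:Z < x * a%:Z
  => [hwlog le_x le_y neq_xy | le_x le_y _].
  have [lt_yx | le_xy] := ltP (y * b%:Z) (x * a%:Z); first exact: hwlog.
  by have := hwlog (- x) (- y); rewrite !abszN; lia.
have [x_gt0 | x_le0] := ltP 0 x.
  by have := @nddot_le_diff a b s `|x| y; lia.
have y_lt0 : y < 0 by nia.
by have := @nddot_le_diff b a s `|y| (- x); lia.
Qed.

Lemma nddot_leq_pred (a b s : nat) : (nddot a b s <= b.-1)%N.
Proof. by apply/bigmax_leqP_seq => n; rewrite mem_index_iota; lia. Qed.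

Lemma dvdn_leq_nddot_eq0 (a b s t : nat) :
  (t <= nddot a b s)%N -> (b %| t)%N -> t = 0%N.
Proof.
move=> /leq_trans/(_ (nddot_leq_pred a b s)) le_tb dvd_bt.
by case: t le_tb dvd_bt => // t le_tb /dvdn_leq; lia.
Qed.

Lemma small_combination_eq0 (a b s : nat) (x y : int) :
  coprime a b -> (`|x| <= nddot a b s)%N -> (`|y| <= nddot b a s)%N ->
  `|x * a%:Z - y * b%:Z| < s%:Z -> x = 0 /\ y = 0.
Proof.
move=> co_ab le_x le_y; rewrite ltNge => small.
have eq_xy : (`|x| * a = `|y| * b)%N.
  rewrite -[a]/(`|a%:Z|%N) -[b in RHS]/(`|b%:Z|%N) -!abszM; congr absz.
  by apply/eqP; apply: contraNT small; apply: nddot_le_combination.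
have co_ba : coprime b a by rewrite coprime_sym.
split; apply/eqP; rewrite -absz_eq0; apply/eqP.
  apply: dvdn_leq_nddot_eq0 le_x _.
  by rewrite -(Gauss_dvdl _ co_ba) eq_xy dvdn_mull.
apply: dvdn_leq_nddot_eq0 le_y _.
by rewrite -(Gauss_dvdl _ co_ab) -eq_xy dvdn_mull.
Qed.

Lemma small_gcd_combination_eq0 (a b s : nat) (x y : int) :
  (`|x| <= nddot (a %/ gcdn a b) (b %/ gcdn a b) s)%N ->
  (`|y| <= nddot (b %/ gcdn a b) (a %/ gcdn a b) s)%N ->
  `|x * a%:Z - y * b%:Z| < (gcdn a b * s)%N%:Z -> x = 0 /\ y = 0.
Proof.
set g := gcdn a b => le_x le_y small.
have g_gt0 : (0 < g)%N by lia.
have aE : a = (a %/ g * g)%N by rewrite divnK ?dvdn_gcdl.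
have bE : b = (b %/ g * g)%N by rewrite divnK ?dvdn_gcdr.
have co_ab : coprime (a %/ g) (b %/ g).
  by rewrite /coprime -(eqn_pmul2r g_gt0) muln_gcdl -aE -bE mul1n.
have scaleE : x * a%:Z - y * b%:Z =
    (x * (a %/ g)%N%:Z - y * (b %/ g)%N%:Z) * g%:Z.
  by rewrite mulrBl -!mulrA -!PoszM -aE -bE.
apply: small_combination_eq0 co_ab le_x le_y _.
by move: small; rewrite scaleE normrM mulnC PoszM ltr_pM2r.
Qed.

Section RemainderGroup.

Variables (I : finType) (M : I -> nat).

Definition family_lcm : nat := \big[lcmn/1%N]_k M k.

Definition folding (N : nat) : {ffun I -> int} := [ffun k => (N %/ M k)%N%:Z].

Definition remainder_diff (N N' : nat) (k : I) : int :=
  (N %% M k)%N%:Z - (N' %% M k)%N%:Z.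

Lemma sub_remainder_diff (N N' : nat) (k : I) :
  N%:Z - N'%:Z - remainder_diff N N' k =
  (folding N k - folding N' k) * (M k)%:Z.
Proof.
rewrite !ffunE /remainder_diff {1}(divn_eq N (M k)) {1}(divn_eq N' (M k)); lia.
Qed.

Lemma dvdz_sub_remainder_diff (d N N' : nat) (k : I) :
  (d %| M k)%N -> (d%:Z %| N%:Z - N'%:Z - remainder_diff N N' k)%Z.
Proof. by move=> dvd_d; rewrite sub_remainder_diff dvdz_mull // dvdzE. Qed.

Lemma remainder_diff_const (m N N' : nat) :
  (forall k, m %| M k)%N -> (forall k, 2 * `|remainder_diff N N' k| < m%:Z) ->
  forall k l, remainder_diff N N' k = remainder_diff N N' l.
Proof.
move=> dvd_mM small k l.
have dvd_m i := dvdz_sub_remainder_diff N N' (dvd_mM i).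
have: (m%:Z %| remainder_diff N N' k - remainder_diff N N' l)%Z.
  suff -> : remainder_diff N N' k - remainder_diff N N' l =
      (N%:Z - N'%:Z - remainder_diff N N' l) -
      (N%:Z - N'%:Z - remainder_diff N N' k).
    exact: rpredB.
  by lia.
case/dvdzP=> q qE; move: (small k) (small l) => small_k small_l.
have: `|q * m%:Z| < m%:Z by rewrite -qE; lia.
rewrite normrM => lt_qm; have q0 : q = 0 by nia.
by apply/eqP; rewrite -subr_eq0 qE q0 mul0r.
Qed.

Lemma const_remainder_diff_decomposition (N N' : nat) (e : int) :
  (forall k, remainder_diff N N' k = e) ->
  exists A, N%:Z - N'%:Z = A * family_lcm%:Z + e.
Proof.
move=> diffE; suff /dvdzP[A AE] : (family_lcm%:Z %| N%:Z - N'%:Z - e)%Z.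
  by exists A; rewrite -AE subrK.
rewrite dvdzE; apply/dvdn_biglcmP => k _.
by have := dvdz_sub_remainder_diff N N' (dvdnn (M k)); rewrite diffE dvdzE.
Qed.

(* Since N - (N mod M k) lies in [0, N], the error does not enter the bound. *)
Lemma lcm_coefficient_leq (N N' n : nat) (A : int) (k : I) :
  (N < family_lcm * (1 + n))%N -> (N' < family_lcm * (1 + n))%N ->
  N%:Z - N'%:Z = A * family_lcm%:Z + remainder_diff N N' k -> (`|A| <= n)%N.
Proof.
rewrite /remainder_diff => lt_N lt_N' NE.
have := leq_mod N (M k); have := leq_mod N' (M k) => le_N' le_N.
have lt_A : (`|A| * family_lcm < family_lcm * (1 + n))%N.
  by rewrite -[X in (_ * X < _)%N]/(`|family_lcm%:Z|%N) -abszM; lia.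
by move: lt_A; rewrite mulnC ltn_mul2l add1n => /andP[].
Qed.

Lemma eq_folding (N N' : nat) :
  (forall k, N%:Z - N'%:Z = remainder_diff N N' k) -> folding N = folding N'.
Proof.
move=> NE; apply/ffunP => k; have [Mk0 | Mk_neq0] := eqVneq (M k) 0%N.
  by rewrite !ffunE Mk0 !divn0.
have /esym/eqP := sub_remainder_diff N N' k.
by rewrite -NE subrr mulf_eq0 eqz_nat (negPf Mk_neq0) orbF subr_eq0 => /eqP.
Qed.

Section ErroneousRemainders.

Variables (R : realFieldType) (tau : R).

Definition compatible (r : I -> int) (N : nat) : bool :=
  [forall k, `|r k - (N %% M k)%N%:Z|%:~R <= tau].

Lemma compatible_remainder_diff (r : I -> int) (N N' : nat) (k : I) :
  compatible r N -> compatible r N' -> `|remainder_diff N N' k|%:~R <= 2 * tau.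
Proof.
move=> /forallP/(_ k) err_N /forallP/(_ k) err_N'.
have : `|remainder_diff N N' k| <=
    `|r k - (N %% M k)%N%:Z| + `|r k - (N' %% M k)%N%:Z|.
  by rewrite /remainder_diff; lia.
by rewrite -(ler_int R) intrD; lra.
Qed.

Lemma compatible_decomposition (m n : nat) (r : I -> int) (N N' : nat)
    (k0 : I) :
  (forall k, m %| M k)%N -> tau < m%:R / 4 ->
  compatible r N -> compatible r N' ->
  (N < family_lcm * (1 + n))%N -> (N' < family_lcm * (1 + n))%N ->
  exists A e : int,
  [/\ N%:Z - N'%:Z = A * family_lcm%:Z + e, `|e|%:~R <= 2 * tau,
      (`|A| <= n)%N & A = 0 -> folding N = folding N'].
Proof.
move=> dvd_mM lt_tau okN okN' lt_N lt_N'.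
have le_diff k := compatible_remainder_diff k okN okN'.
have diffE k : remainder_diff N N' k = remainder_diff N N' k0.
  apply: remainder_diff_const dvd_mM _ _ _ => l.
  by rewrite -(ltr_int R) intrM -pmulrn; have := le_diff l; lra.
have [A AE] := const_remainder_diff_decomposition diffE.
exists A, (remainder_diff N N' k0); split=> // [|A0].
  exact: lcm_coefficient_leq lt_N lt_N' AE.
by apply: eq_folding => k; rewrite diffE AE A0 mul0r add0r.
Qed.

End ErroneousRemainders.

End RemainderGroup.

Section TwoGroups.

Variables (R : realFieldType) (I1 I2 : finType).
Variables (M1 : I1 -> nat) (M2 : I2 -> nat).
Variables (tau1 tau2 : R) (m1 m2 s : nat).

Hypothesis dvd_M1 : forall k, (m1 %| M1 k)%N.
Hypothesis dvd_M2 : forall k, (m2 %| M2 k)%N.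
Hypotheses (lt_tau1 : tau1 < m1%:R / 4) (lt_tau2 : tau2 < m2%:R / 4).

Let eta1 := family_lcm M1.
Let eta2 := family_lcm M2.
Let Gam1 := (eta1 %/ gcdn eta1 eta2)%N.
Let Gam2 := (eta2 %/ gcdn eta1 eta2)%N.
Let X := minn (eta2 * (1 + nddot Gam2 Gam1 s)) (eta1 * (1 + nddot Gam1 Gam2 s)).

Hypothesis lt_tau12 : tau1 + tau2 < (gcdn eta1 eta2 * s)%N%:R / 2.

Lemma folding_unique (k1 : I1) (k2 : I2) (r1 : I1 -> int) (r2 : I2 -> int)
    (N N' : nat) :
  (N < X)%N -> (N' < X)%N ->
  compatible M1 tau1 r1 N && compatible M2 tau2 r2 N ->
  compatible M1 tau1 r1 N' && compatible M2 tau2 r2 N' ->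
  (folding M1 N, folding M2 N) = (folding M1 N', folding M2 N').
Proof.
rewrite !leq_min => /andP[lt2 lt1] /andP[lt2' lt1'].
move=> /andP[ok1 ok2] /andP[ok1' ok2'].
have [A1 [e1 [NE1 le_e1 le_A1 eq1]]] :=
  compatible_decomposition k1 dvd_M1 lt_tau1 ok1 ok1' lt1 lt1'.
have [A2 [e2 [NE2 le_e2 le_A2 eq2]]] :=
  compatible_decomposition k2 dvd_M2 lt_tau2 ok2 ok2' lt2 lt2'.
have small_errors : `|e2 - e1| < (gcdn eta1 eta2 * s)%N%:Z.
  have := ler_normB e2 e1; rewrite -(ler_int R) -(ltr_int R) intrD -pmulrn.
  by move: lt_tau12 le_e1 le_e2; lra.
have small : `|A1 * eta1%:Z - A2 * eta2%:Z| < (gcdn eta1 eta2 * s)%N%:Z.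
  suff -> : A1 * eta1%:Z - A2 * eta2%:Z = e2 - e1 by [].
  by move: NE1; rewrite NE2 /eta1 /eta2; lia.
have [A1_0 A2_0] := small_gcd_combination_eq0 le_A1 le_A2 small.
by rewrite eq1 // eq2.
Qed.

End TwoGroups.

Lemma ex_decoder (T U : Type) (X : nat) (ok : T -> pred nat) (f : nat -> U) :
  (forall t N N', (N < X)%N -> (N' < X)%N -> ok t N -> ok t N' -> f N = f N') ->
  exists Phi : T -> U, forall N, (N < X)%N -> forall t, ok t N -> Phi t = f N.
Proof.
move=> f_uniq.
exists (fun t => if [pick N : 'I_X | ok t N] is Some N then f N else f 0%N).
move=> N lt_NX t okN; case: pickP => [N' okN' | /(_ (Ordinal lt_NX))].
  exact: f_uniq okN' okN.
by rewrite /= okN.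
Qed.

Theorem theorem3 (R : realFieldType)
  (L1 L2 : nat) (m1 m2 : nat) (G1 : 'I_L1 -> nat) (G2 : 'I_L2 -> nat)
  (hL1 : (1 <= L1)%N) (hL2 : (1 <= L2)%N)
  (hm1 : (1 <= m1)%N) (hm2 : (1 <= m2)%N)
  (hG1 : forall k, (1 <= G1 k)%N) (hG2 : forall k, (1 <= G2 k)%N)
  (hcop1 : forall k k', k != k' -> coprime (G1 k) (G1 k'))
  (hcop2 : forall k k', k != k' -> coprime (G2 k) (G2 k'))
  (heta : (lcm_moduli m1 G1 < lcm_moduli m2 G2)%N)
  (hGam1 : (1 < lcm_moduli m1 G1 %/ gcdn (lcm_moduli m1 G1) (lcm_moduli m2 G2))%N)
  (K : nat)
  (hK1 : (1 < sigma (lcm_moduli m1 G1 %/ gcdn (lcm_moduli m1 G1) (lcm_moduli m2 G2))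
                    (lcm_moduli m2 G2 %/ gcdn (lcm_moduli m1 G1) (lcm_moduli m2 G2)) K)%N)
  (hK2 : sigma (lcm_moduli m1 G1 %/ gcdn (lcm_moduli m1 G1) (lcm_moduli m2 G2))
               (lcm_moduli m2 G2 %/ gcdn (lcm_moduli m1 G1) (lcm_moduli m2 G2)) K.+1 = 1%N)
  (j : nat) (hj : (1 <= j <= K.+1)%N)
  (tau1 tau2 : R) (ht1 : 0 <= tau1) (ht2 : 0 <= tau2)
  (ht1m : tau1 < m1%:R / 4) (ht2m : tau2 < m2%:R / 4)
  (ht12 : tau1 + tau2 <
     (gcdn (lcm_moduli m1 G1) (lcm_moduli m2 G2) *
      sigma (lcm_moduli m1 G1 %/ gcdn (lcm_moduli m1 G1) (lcm_moduli m2 G2))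
            (lcm_moduli m2 G2 %/ gcdn (lcm_moduli m1 G1) (lcm_moduli m2 G2)) j)%N%:R / 2) :
  let eta1 := lcm_moduli m1 G1 in
  let eta2 := lcm_moduli m2 G2 in
  let mg := gcdn eta1 eta2 in
  let Gam1 := (eta1 %/ mg)%N in
  let Gam2 := (eta2 %/ mg)%N in
  let sj := sigma Gam1 Gam2 j in
  let X := minn (eta2 * (1 + nddot Gam2 Gam1 sj)) (eta1 * (1 + nddot Gam1 Gam2 sj)) in
  exists Phi : {ffun 'I_L1 -> int} * {ffun 'I_L2 -> int} ->
               {ffun 'I_L1 -> int} * {ffun 'I_L2 -> int},
    forall N : nat, (N < X)%N ->
    forall (r1 : {ffun 'I_L1 -> int}) (r2 : {ffun 'I_L2 -> int}),
      (forall k, 0 <= r1 k < (m1 * G1 k)%N%:Z /\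
                 (`|r1 k - (N %% (m1 * G1 k))%N%:Z|)%:~R <= tau1) ->
      (forall k, 0 <= r2 k < (m2 * G2 k)%N%:Z /\
                 (`|r2 k - (N %% (m2 * G2 k))%N%:Z|)%:~R <= tau2) ->
      Phi (r1, r2) = ([ffun k => (N %/ (m1 * G1 k))%N%:Z],
                      [ffun k => (N %/ (m2 * G2 k))%N%:Z]).
Proof.
move=> eta1 eta2 mg Gam1 Gam2 sj X.
pose M1 k := (m1 * G1 k)%N; pose M2 k := (m2 * G2 k)%N.
pose ok (r : {ffun 'I_L1 -> int} * {ffun 'I_L2 -> int}) N :=
  compatible M1 tau1 r.1 N && compatible M2 tau2 r.2 N.
have [r N N' | Phi PhiE] :=
  @ex_decoder _ _ X ok (fun N => (folding M1 N, folding M2 N)).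
  apply: folding_unique ht1m ht2m ht12 (Ordinal hL1) (Ordinal hL2) _ _ _ _ => k;
    exact: dvdn_mulr.
exists Phi => N lt_NX r1 r2 err1 err2; apply: PhiE => //.
by apply/andP; split; apply/forallP => k; [case: (err1 k) | case: (err2 k)].
Qed.
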